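(* Let $V$ be a finite set with $|V|=n$ and let $K$ be a convex cone contained in $\{x\in\mathbb{R}^{\mathcal{P}_1(V)}\mid 0\le x_i\le x_{\mathbf 0}\ (i\in V)\}$. Then $\widetilde L^1(K)=N_+(K)$, and $\widetilde L^t(K)\subseteq N_+^t(K)$ for all integers $t$ with $2\le t\le n+1$.
   Context: For a finite set $V$ and an integer $r\ge0$, $\mathcal{P}_r(V)$ (resp. $\mathcal{P}_{=r}(V)$) is the collection of subsets of $V$ of cardinality at most $r$ (resp. exactly $r$). $\mathbf 0$ denotes the empty set and $\{i\}$ is identified with $i$. The standard unit vectors of $\mathbb{R}^{\mathcal{P}_1(V)}$ are $e_{\mathbf 0}$, $e_i$ ($i\in V$). ''$\succeq0$'' means ''is (symmetric) positive semidefinite''. Convex cones contain the origin. Lovász–Schrijver hierarchy: $\mathcal{M}_{+,V}:=\{Y\in\mathbb{R}^{\mathcal{P}_1(V)\times\mathcal{P}_1(V)}\mid Y\succeq0,\ Y_{ii}=Y_{\mathbf 0i}\ (i\in V)\}$; $\mathcal{M}_+(K):=\{Y\in\mathcal{M}_{+,V}\mid Ye_i\in K,\ Y(e_{\mathbf 0}-e_i)\in K\ (i\in V)\}$; $N_+(K):=\{Ye_{\mathbf 0}\mid Y\in\mathcal{M}_+(K)\}$; $N_+^0(K):=K$ and $N_+^t(K):=N_+(N_+^{t-1}(K))$ for $t\ge1$ (so $N_+^1(K)=N_+(K)$). The hierarchy $\widetilde L^t$: for $S\subseteq V$ let $\mathcal{A}_S:=\{S\}\cup\{S\cup\{i\}\mid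 i\in V\}$ and for $T\subseteq V$ let $\mathcal{A}(T):=\bigcup_{S\subseteq T}\mathcal{A}_S$ (multisets, repetitions kept). For $|T|=t-1$ and $y\in\mathbb{R}^{\mathcal{P}_{t+1}(V)}$, $M(T;y)$ is the matrix indexed by $\mathcal{A}(T)$ with $(I,J)$-entry $y_{I\cup J}$. For $S\subseteq T$, $A_S(y)$ is the symmetric matrix indexed by $\mathcal{P}_1(V)$ with $A_S(y)_{\mathbf 0,\mathbf 0}=y_S$, $A_S(y)_{\mathbf 0,i}=y_{S\cup\{i\}}$, $A_S(y)_{i,j}=y_{S\cup\{i,j\}}$ ($i,j\in V$), and $A(S,T)(y):=\sum_{S':\,S\subseteq S'\subseteq T}(-1)^{|S'\setminus S|}A_{S'}(y)$. For $t\ge1$, $\widetilde L^t(K)$ is the set of all $x\in\mathbb{R}^{\mathcal{P}_1(V)}$ for which there exists $y\in\mathbb{R}^{\mathcal{P}_{t+1}(V)}$ such that $y_{\mathbf 0}=x_{\mathbf 0}$, $y_i=x_i$ ($i\in V$); $M(T;y)\succeq0$ for all $T\in\mathcal{P}_{=(t-1)}(V)$; and $A(S,T)(y)e_i\in K$, $A(S,T)(y)(e_{\mathbf 0}-e_i)\in K$ for all $T\in\mathcal{P}_{=(t-1)}(V)$, $S\subseteq T$, $i\in V$. *)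

(* Defs.v *)
From HB Require Import structures.
From mathcomp Require Import all_boot all_order all_algebra.
From mathcomp Require Import all_classical all_reals convex.

Set Implicit Arguments.
Unset Strict Implicit.
Unset Printing Implicit Defensive.

Import Order.TTheory GRing.Theory Num.Theory.

Local Open Scope classical_set_scope.
Local Open Scope ring_scope.

(* A vector of R^I, for a finite type I, is a column vector of height #|I|,
   and an I x I matrix is a square matrix of size #|I|; the coordinate of
   index a : I sits at position enum_rank a. *)
Notation vec R I := 'cV[R]_#|I|.
Notation mat R I := 'M[R]_#|I|.

Definition coordv (R : realType) (I : finType) (x : vec R I) (a : I) : R :=
  x (enum_rank a) 0.

Definition coordm (R : realType) (I : finType) (Y : mat R I) (a b : I) : R :=
  Y (enum_rank a) (enum_rank b).

Definition mkmat (R : realType) (I : finType) (f : I -> I -> R) : mat R I :=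
  \matrix_(i, j) f (enum_val i) (enum_val j).

Definition unitv (R : realType) (I : finType) (a : I) : vec R I :=
  delta_mx (enum_rank a) 0.

Definition psd (R : realType) (m : nat) (Y : 'M[R]_m) : Prop :=
  Y^T = Y /\ forall u : 'cV[R]_m, 0 <= (u^T *m Y *m u) 0 0.

Definition convex_cone (R : realType) (m : nat) (K : set 'cV[R]_m) : Prop :=
  [/\ convex_set K, K 0 & forall (a : R) x, 0 <= a -> K x -> K (a *: x)].

Definition subsets_le (V : finType) (r : nat) : finType :=
  {S : {set V} | (#|S| <= r)%N}.

Lemma card_set0_le1 (V : finType) : (#|finset.set0 : {set V}| <= 1)%N.
Proof. by rewrite cards0. Qed.

Lemma card_set1_le1 (V : finType) (i : V) : (#|[set i]%SET| <= 1)%N.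
Proof. by rewrite cards1. Qed.

Definition ix0 (V : finType) : subsets_le V 1 :=
  exist _ finset.set0 (card_set0_le1 V).

Definition ix1 (V : finType) (i : V) : subsets_le V 1 :=
  exist _ [set i]%SET (card_set1_le1 i).

Section LovaszSchrijver.
Variables (R : realType) (V : finType).
Local Notation P1 := (subsets_le V 1).

Definition MplusV : set (mat R P1) :=
  [set Y | psd Y /\
    forall i : V, coordm Y (ix1 i) (ix1 i) = coordm Y (ix0 V) (ix1 i)].

Definition Mplus (K : set (vec R P1)) : set (mat R P1) :=
  [set Y | MplusV Y /\
    forall i : V, K (Y *m unitv R (ix1 i)) /\
                  K (Y *m (unitv R (ix0 V) - unitv R (ix1 i)))].

Definition Nplus (K : set (vec R P1)) : set (vec R P1) :=
  [set Y *m unitv R (ix0 V) | Y in Mplus K].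

Definition Nplus_iter (t : nat) (K : set (vec R P1)) : set (vec R P1) :=
  iter t Nplus K.

End LovaszSchrijver.

Section Ltilde.
Variables (R : realType) (V : finType).
Local Notation P1 := (subsets_le V 1).

(* y_S; the default 0 is never read below, where #|S| <= r always holds. *)
Definition entry (r : nat) (y : vec R (subsets_le V r)) (S : {set V}) : R :=
  if insub S is Some a then coordv y a else 0.

(* The multiset A(T): the pair (S, a) stands for the copy of the set S :|: a
   coming from A_S, so that repetitions are kept. *)
Definition multA (T : {set V}) : finType :=
  ({S : {set V} | S \subset T} * P1)%type.

Definition multA_set (T : {set V}) (I : multA T) : {set V} :=
  val I.1 :|: val I.2.

Definition momentM (r : nat) (T : {set V}) (y : vec R (subsets_le V r)) :
    mat R (multA T) :=
  mkmat (fun I J => entry y (multA_set I :|: multA_set J)).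

Definition matA (r : nat) (S : {set V}) (y : vec R (subsets_le V r)) :
    mat R P1 :=
  mkmat (fun a b : P1 => entry y (S :|: val a :|: val b)).

Definition matAST (r : nat) (S T : {set V}) (y : vec R (subsets_le V r)) :
    mat R P1 :=
  \sum_(S' : {set V} | (S \subset S') && (S' \subset T))
    (-1) ^+ #|S' :\: S| *: matA S' y.

(* Only meaningful for t >= 1. *)
Definition Ltilde (t : nat) (K : set (vec R P1)) : set (vec R P1) :=
  [set x | exists y : vec R (subsets_le V t.+1),
    [/\ entry y finset.set0 = coordv x (ix0 V),
        forall i : V, entry y [set i]%SET = coordv x (ix1 i),
        forall T : {set V}, #|T| = t.-1 -> psd (momentM T y) &
        forall (T S : {set V}) (i : V), #|T| = t.-1 -> S \subset T ->
          K (matAST S T y *m unitv R (ix1 i)) /\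
          K (matAST S T y *m (unitv R (ix0 V) - unitv R (ix1 i)))]].

End Ltilde.

(* Main.v *)
Require Import Defs.
From mathcomp Require Import all_boot all_order all_algebra.
From mathcomp Require Import all_classical all_reals.
From mathcomp Require Import interval_inference.

Set Implicit Arguments.
Unset Strict Implicit.
Unset Printing Implicit Defensive.

(** Write y for the moment vector witnessing that x lies in level t of the
tilde hierarchy.  The matrix Y := A_set0(y) is positive semidefinite, has
Y e_0 = x and satisfies Y_ii = Y_0i, so everything rests on the columns Y e_i
and Y (e_0 - e_i).  The point is that these columns lie in level t - 1, with
explicit witnesses: the shift I |-> y_(i + I) for the former and the co-shift
I |-> y_I - y_(i + I) for the latter (here i + I is the union of I and {i}).
Induction on t then gives the inclusion in the iterates of N_+.

The conditions are inherited by the two new vectors for the following reasons.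
Given T' of size t - 2, choose T of size t - 1 containing both T' and i.
- Positive semidefiniteness ([psd_unionm_shift], [psd_unionm_coshift]).  The
  matrix of the shift is obtained from M(T; y) by selecting the rows and
  columns i + I, for I in A(T').  The matrix of the co-shift is the Gram matrix
  of the vectors e_I - e_(i + I) for the form M(T; y), because union with i is
  idempotent: three of the four terms of the expansion coincide up to sign.
- Membership in K ([level_positive_shift], [level_positive_coshift]).  Write
  A(S, T) for the alternating sum over the Boolean interval from S to T.  If i
  is not in T', the sum A(S, T') of the shift is A(i + S, i + T') of y and that
  of the co-shift is A(S, i + T') of y.  If i is in T', one of the two sums
  vanishes and the other is A(S, T') of y, which is not itself constrained;
  but A(S, T') = A(S, k + T') + A(k + S, k + T') for any k outside T', and a
  convex cone is closed under addition.

At level 1 the only interval is trivial, so the first inclusion specialises to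
one half of the equality with N_+(K).  For the other half, a matrix Y of N_+
is a moment matrix: Y_ij depends only on the union of i and j, by symmetry and
Y_ii = Y_0i ([pair_momentsE]).

Moment vectors are replaced throughout by functions on all sets of vertices
([LtildeP]), so that shifting needs no bookkeeping of cardinalities. *)

Import Order.TTheory GRing.Theory Num.Theory.

Local Open Scope classical_set_scope.
Local Open Scope ring_scope.

(** * Convex cones and positive semidefinite matrices *)

Lemma convex_coneD (R : realType) (m : nat) (K : set 'cV[R]_m) (x y : 'cV_m) :
  convex_cone K -> K x -> K y -> K (x + y).
Proof.
move=> [convK _ scaleK] Kx Ky.
have half_ge0 : 0 <= 2^-1 :> R by rewrite invr_ge0 ler0n.
have half_le1 : 2^-1 <= 1 :> R by rewrite invf_le1 ?ler1n ?ltr0n.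
have := convK x y (Itv01 half_ge0 half_le1).
rewrite !inE => /(_ Kx Ky) Kmid.
have {Kmid} : K (2^-1 *: x + (1 - 2^-1) *: y) by exact: Kmid.
have -> : 1 - 2^-1 = 2^-1 :> R by rewrite {1}(splitr 1) div1r addrK.
move=> /(scaleK 2 _ (ler0n _ 2)).
by rewrite scalerDr !scalerA divff ?pnatr_eq0// !scale1r.
Qed.

Lemma psd_congruence (R : realType) (m p : nat) (M : 'M[R]_m) (B : 'M_(m, p)) :
  psd M -> psd (B^T *m M *m B).
Proof.
move=> [symM posM]; split; first by rewrite !trmx_mul symM trmxK mulmxA.
by move=> u; have := posM (B *m u); rewrite trmx_mul !mulmxA.
Qed.

(** The form M evaluated on any family of vectors gives a positive semidefinite
matrix; both the selection of rows and the co-shift are of this kind. *)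
Lemma psd_gram (R : realType) (I J : finType) (M : mat R I) (v : J -> vec R I) :
  psd M -> psd (mkmat (fun a b : J => ((v a)^T *m M *m v b) 0 0)).
Proof.
move=> /(psd_congruence (\matrix_(i < #|I|, j < #|J|) v (enum_val j) i 0)).
congr psd; apply/matrixP => i j; rewrite !mxE; apply: eq_bigr => k _.
by rewrite !mxE; congr (_ * _); apply: eq_bigr => l _; rewrite !mxE.
Qed.

Lemma unitv_form (R : realType) (I : finType) (f : I -> I -> R) (a b : I) :
  ((unitv R a)^T *m mkmat f *m unitv R b) 0 0 = f a b.
Proof. by rewrite trmx_delta -rowE -colE !mxE !enum_rankK. Qed.

Lemma psd_reindex (R : realType) (I J : finType) (f : I -> I -> R)
    (phi : J -> I) :
  psd (mkmat f) -> psd (mkmat (fun a b => f (phi a) (phi b))).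
Proof.
move=> /(psd_gram (fun a => unitv R (phi a))).
by congr psd; apply/matrixP => i j; rewrite [LHS]mxE [RHS]mxE unitv_form.
Qed.

Lemma psd_difference (R : realType) (I J : finType) (f : I -> I -> R)
    (phi psi : J -> I) :
  psd (mkmat f) ->
  psd (mkmat (fun a b => f (phi a) (phi b) - f (phi a) (psi b)
                         - (f (psi a) (phi b) - f (psi a) (psi b)))).
Proof.
move=> /(psd_gram (fun a => unitv R (phi a) - unitv R (psi a))).
congr psd; apply/matrixP => i j; rewrite [LHS]mxE [RHS]mxE.
have subE (A B : 'M[R]_1) : (A - B) 0 0 = A 0 0 - B 0 0 by rewrite !mxE.
by rewrite [(_ - _)^T]linearB /= !mulmxBl !mulmxBr !subE !unitv_form.
Qed.

Lemma mkmat_unitv (R : realType) (I : finType) (f : I -> I -> R) (b : I) :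
  mkmat f *m unitv R b = \col_i f (enum_val i) b.
Proof. by apply/colP => i; rewrite -colE !mxE enum_rankK. Qed.

(** * Alternating sums over Boolean intervals *)

Section AlternatingSums.
Variables (R : pzRingType) (V : finType) (W : lmodType R).
Implicit Types (S T : {set V}) (g h : {set V} -> W) (i k : V).

(** The combination A(S, T) of the hierarchy, for a family g of vectors in place
of the matrices A_S'(y). *)
Definition altsum S T g : W :=
  \sum_(S' : {set V} | (S \subset S') && (S' \subset T))
    (-1) ^+ #|S' :\: S| *: g S'.

Lemma altsumB S T g h :
  altsum S T (fun S' => g S' - h S') = altsum S T g - altsum S T h.
Proof. by rewrite -sumrB; apply: eq_bigr => S' _; rewrite scalerBr. Qed.

Lemma eq_altsum S T g h :
  (forall S', S \subset S' -> S' \subset T -> g S' = h S') ->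
  altsum S T g = altsum S T h.
Proof. by move=> gh; apply: eq_bigr => S' /andP[? ?]; rewrite gh. Qed.

Lemma setDU1_id (k : V) (A B : {set V}) :
  k \notin A -> k \notin B -> (k |: A) :\: (k |: B) = A :\: B.
Proof.
move=> kA kB; apply/setP => x; rewrite !inE.
by case: eqVneq => [->|//]; rewrite (negPf kA) andbF.
Qed.

Lemma setU1_subset2 k (A B : {set V}) :
  k \notin A -> k \notin B -> (k |: A \subset k |: B) = (A \subset B).
Proof.
move=> kA kB; apply/idP/idP; last exact: finset.setUS.
by move=> /(finset.setSD [set k]); rewrite !setU1K.
Qed.

(** Adding k is a bijection from the interval [S, T] to [k |: S, k |: T] that
preserves the signs. *)
Lemma altsum_contract k S T g : k \notin T -> S \subset T ->
  altsum (k |: S) (k |: T) g = altsum S T (fun S' => g (k |: S')).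
Proof.
move=> kT sST; have kS : k \notin S := contra (fintype.subsetP sST k) kT.
rewrite /altsum.
rewrite (reindex_onto (fun A => k |: A) (fun B => B :\ k)) /=; last first.
  move=> B /andP[kSB _].
  by rewrite finset.setD1K// (fintype.subsetP kSB)// setU11.
have memP (A : {set V}) : (k |: S \subset k |: A) && (k |: A \subset k |: T)
    && ((k |: A) :\ k == A) = (S \subset A) && (A \subset T).
  case kA: (k \in A).
    have -> : (k |: A) :\ k == A = false.
      by apply/eqP => /setP/(_ k); rewrite !inE eqxx kA.
    rewrite andbF; apply/esym/negP => /andP[_ /fintype.subsetP/(_ k kA)].
    by apply/negP.
  by rewrite setU1K ?kA// eqxx andbT !setU1_subset2 ?kA.
apply: eq_big => [A|A]; first exact: memP.
rewrite memP => /andP[_ /fintype.subsetP sAT].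
by rewrite setDU1_id//; apply: contra kT; apply: sAT.
Qed.

(** The interval [S, k |: T] splits into the sets avoiding k and those
containing k; the latter form [k |: S, k |: T], with all signs reversed since
the signs are now counted from S. *)
Lemma altsum_delete k S T g : k \notin T -> S \subset T ->
  altsum S (k |: T) g = altsum S T g - altsum (k |: S) (k |: T) g.
Proof.
move=> kT sST; have kS : k \notin S := contra (fintype.subsetP sST k) kT.
rewrite /altsum (bigID (fun A : {set V} => k \in A)) /= addrC; congr (_ + _).
  apply: eq_bigl => A; rewrite -andbA; congr (_ && _).
  case kA: (k \in A); rewrite ?andbF ?andbT.
    by apply/esym/negP => /fintype.subsetP/(_ k kA); apply/negP.
  apply/idP/idP => [/fintype.subsetP sA|/fintype.subset_trans]; last first.
    by apply; apply: finset.subsetUr.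
  apply/fintype.subsetP => x xA; have := sA x xA.
  rewrite !inE => /orP[/eqP xk|//].
  by rewrite -xk xA in kA.
rewrite -sumrN; apply: eq_big => [A|A /andP[_ kA]].
  by rewrite finset.subUset finset.sub1set andbC andbA.
rewrite -scaleNr; congr (_ *: _).
have -> : A :\: S = k |: (A :\: (k |: S)).
  by apply/setP => x; rewrite !inE; case: eqVneq => [->|//]; rewrite kS kA.
by rewrite cardsU1 !inE eqxx /= exprS mulN1r.
Qed.

Lemma altsum_shift_in i S T g : i \in S ->
  altsum S T (fun S' => g (i |: S')) = altsum S T g.
Proof.
move=> iS; apply: eq_altsum => S' /fintype.subsetP/(_ i iS) iS' _.
by rewrite (finset.setUidPr _)// finset.sub1set.
Qed.

(** The terms pair up: S' and i |: S' carry the same vector with opposite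
signs. *)
Lemma altsum_shift_out i S T g : i \in T -> i \notin S -> S \subset T ->
  altsum S T (fun S' => g (i |: S')) = 0.
Proof.
move=> iT iS sST; have sST' : S \subset T :\ i by rewrite finset.subsetD1 sST.
rewrite -(finset.setD1K iT) altsum_delete ?setD11// altsum_contract ?setD11//.
apply/eqP; rewrite subr_eq0; apply/eqP/eq_altsum => S' _ _.
by rewrite finset.setUA finset.setUid.
Qed.

Lemma altsum_point g : altsum finset.set0 finset.set0 g = g finset.set0.
Proof.
rewrite /altsum (big_pred1 finset.set0) => [|A].
  by rewrite finset.setDv cards0 scale1r.
by rewrite finset.sub0set finset.subset0.
Qed.

Lemma exists_notin d T : (d < #|V|)%N -> #|T| = d -> exists k, k \notin T.
Proof.
move=> dV Td; suff /subsetPn[k _ kT] : ~~ ([set: V]%SET \subset T) by exists k.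
by apply: contraL dV => /subset_leq_card; rewrite cardsT Td -leqNgt.
Qed.

Definition level_positive (P : W -> Prop) (d : nat) g :=
  forall T S, #|T| = d -> S \subset T -> P (altsum S T g).

Lemma level_positive0 (P : W -> Prop) g :
  level_positive P 0 g <-> P (g finset.set0).
Proof.
split=> [Pg|Pg T S /cards0_eq ->].
  by rewrite -(altsum_point g); apply: Pg; rewrite ?cards0.
by rewrite finset.subset0 => /eqP ->; rewrite altsum_point.
Qed.

Variable P : W -> Prop.
Hypotheses (P0 : P 0) (PD : forall u v, P u -> P v -> P (u + v)).

(** An interval [S, T] is the sum of the two intervals [S, k |: T] and
[k |: S, k |: T] of the next level; the bound on d provides such a k. *)
Lemma level_positive_down d g : (d < #|V|)%N ->
  level_positive P d.+1 g -> level_positive P d g.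
Proof.
move=> dV Pg T S Td sST.
have [k kT] := exists_notin dV Td.
rewrite -[altsum S T g](subrK (altsum (k |: S) (k |: T) g)) -altsum_delete//.
apply: PD; apply: Pg.
- by rewrite cardsU1 kT Td.
- exact: fintype.subset_trans sST (finset.subsetUr _ _).
- by rewrite cardsU1 kT Td.
- exact: finset.setUS.
Qed.

Lemma level_positive_shift i d g : (d < #|V|)%N ->
  level_positive P d.+1 g -> level_positive P d (fun S => g (i |: S)).
Proof.
move=> dV Pg T S Td sST; have [iT|iT] := boolP (i \in T).
  have [iS|iS] := boolP (i \in S); last by rewrite altsum_shift_out.
  by rewrite altsum_shift_in//; exact: (level_positive_down dV Pg).
rewrite -altsum_contract//; apply: Pg; first by rewrite cardsU1 iT Td.
exact: finset.setUS.
Qed.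

Lemma level_positive_coshift i d g : (d < #|V|)%N ->
  level_positive P d.+1 g -> level_positive P d (fun S => g S - g (i |: S)).
Proof.
move=> dV Pg T S Td sST; rewrite altsumB; have [iT|iT] := boolP (i \in T).
  have [iS|iS] := boolP (i \in S); first by rewrite altsum_shift_in// subrr.
  by rewrite altsum_shift_out// subr0; exact: (level_positive_down dV Pg).
rewrite -altsum_contract// -altsum_delete//; apply: Pg.
  by rewrite cardsU1 iT Td.
exact: fintype.subset_trans sST (finset.subsetUr _ _).
Qed.

End AlternatingSums.

(** * Moment functions *)

Section Moments.
Variables (R : realType) (V : finType).
Local Notation P1 := (subsets_le V 1).
Implicit Types (f : {set V} -> R) (S T : {set V}) (i : V) (a b : P1).

(** Truncation of a function on all sets to a moment vector. *)
Definition fvec (r : nat) f : vec R (subsets_le V r) :=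
  \col_j f (val (enum_val j)).

Lemma entry_fvec r f S : (#|S| <= r)%N -> entry (fvec r f) S = f S.
Proof.
move=> Sr; rewrite /entry; case: insubP => [a _ <-|]; last by rewrite Sr.
by rewrite /coordv mxE enum_rankK.
Qed.

Lemma P1_case (a : P1) : a = ix0 V \/ exists i, a = ix1 i.
Proof.
have := valP a; rewrite /= leq_eqVlt ltnS leqn0 => /orP[/cards1P[i ai]|].
  by right; exists i; apply: val_inj.
by rewrite cards_eq0 => /eqP a0; left; apply: val_inj.
Qed.

(** The matrix A_S(y), read off a function on all sets. *)
Definition localm f S : mat R P1 :=
  mkmat (fun a b => f (S :|: val a :|: val b)).

Lemma localm_shift f i :
  localm (fun I => f (i |: I)) = fun S => localm f (i |: S).
Proof.
by apply/funext => S; apply/matrixP => j k; rewrite !mxE !finset.setUA.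
Qed.

Lemma localmB f g :
  localm (fun I => f I - g I) = fun S => localm f S - localm g S.
Proof. by apply/funext => S; apply/matrixP => j k; rewrite !mxE. Qed.

Lemma coordv_localm f S a b :
  coordv (localm f S *m unitv R b) a = f (S :|: val a :|: val b).
Proof. by rewrite /localm mkmat_unitv /coordv mxE enum_rankK. Qed.

(** The two column conditions shared by [Mplus] and [Ltilde]. *)
Definition in_faces (K : set (vec R P1)) (M : mat R P1) : Prop :=
  forall i, K (M *m unitv R (ix1 i)) /\
            K (M *m (unitv R (ix0 V) - unitv R (ix1 i))).

Lemma in_faces0 K : convex_cone K -> in_faces K 0.
Proof. by move=> [_ K0 _] i; rewrite !mul0mx. Qed.

Lemma in_facesD K M N :
  convex_cone K -> in_faces K M -> in_faces K N -> in_faces K (M + N).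
Proof.
move=> coneK KM KN i; rewrite !(mulmxDl M N).
by split; apply: convex_coneD => //; [apply: (KM i).1|apply: (KN i).1
  |apply: (KM i).2|apply: (KN i).2].
Qed.

(** The matrix M(T; y), read off a function on all sets. *)
Definition unionm T f : mat R (multA T) :=
  mkmat (fun I J => f (multA_set I :|: multA_set J)).

(** The conditions defining level d + 1 of the hierarchy, so that d is the size
of the sets T. *)
Definition moment_witness (d : nat) (K : set (vec R P1)) (x : vec R P1) f
    : Prop :=
  [/\ f finset.set0 = coordv x (ix0 V),
      forall i, f [set i]%SET = coordv x (ix1 i),
      forall T, #|T| = d -> psd (unionm T f) &
      level_positive (in_faces K) d (localm f)].

Lemma card_setU_le (A B : {set V}) m p :
  (#|A| <= m -> #|B| <= p -> #|A :|: B| <= m + p)%N.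
Proof. by move=> *; apply: leq_trans (leq_card_setU _ _) (leq_add _ _). Qed.

Lemma card_multA_setU T (I J : multA T) :
  (#|multA_set I :|: multA_set J| <= #|T|.+2)%N.
Proof.
rewrite /multA_set finset.setUACA -addn2 card_setU_le//.
  by rewrite subset_leq_card// finset.subUset (valP I.1) (valP J.1).
exact: (card_setU_le (valP I.2) (valP J.2)).
Qed.

(** Only the values of f on sets of size at most d + 2 are read, which are
exactly the coordinates of a moment vector of level d + 1. *)
Lemma LtildeP d (K : set (vec R P1)) x :
  Ltilde d.+1 K x <-> exists f, moment_witness d K x f.
Proof.
split=> [[y [y0 yi psdy Ky]]|[f [f0 fi psdf Kf]]].
  exists (entry y); split=> // T S Td sST i; exact: Ky.
exists (fvec d.+2 f); split.
- by rewrite entry_fvec ?cards0.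
- by move=> i; rewrite entry_fvec ?cards1.
- move=> T /= Td; have := psdf T Td.
  congr psd; apply/matrixP => i j; rewrite !mxE entry_fvec//.
  by rewrite -Td card_multA_setU.
move=> T S i /= Td sST; have := Kf T S Td sST i.
rewrite (_ : matAST S T _ = altsum S T (localm f))//.
apply: eq_altsum => S' _ S'T; apply/matrixP => j k; rewrite !mxE entry_fvec//.
rewrite -finset.setUA -Td -addn2 card_setU_le ?subset_leq_card//.
exact: (card_setU_le (valP (enum_val j)) (valP (enum_val k))).
Qed.

Lemma exists_superset1 d T i : (d < #|V|)%N -> #|T| = d ->
  exists T', [/\ #|T'| = d.+1, T \subset T' & i \in T'].
Proof.
move=> + Td; rewrite -Td => TV; have [iT|iT] := boolP (i \in T); last first.
  by exists (i |: T); rewrite cardsU1 iT finset.subsetUr setU11.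
have [k kT] := exists_notin TV erefl.
by exists (k |: T); rewrite cardsU1 kT finset.subsetUr finset.setU1r.
Qed.

Lemma exists_set_card d : (d <= #|V|)%N -> exists T, #|T| = d.
Proof.
rewrite -cardsT -bin_gt0 -cards_draws => /card_gt0P[T].
by rewrite inE => /andP[_ /eqP]; exists T.
Qed.

Definition multA_widen T T' (sT : T' \subset T) (I : multA T') : multA T :=
  (exist _ (val I.1) (fintype.subset_trans (valP I.1) sT), I.2).

Lemma add_subset T T' i (sT : T' \subset T) (iT : i \in T)
  (S : {S : {set V} | S \subset T'}) : i |: val S \subset T.
Proof.
by rewrite finset.subUset finset.sub1set iT (fintype.subset_trans (valP S) sT).
Qed.

Definition multA_add T T' i (sT : T' \subset T) (iT : i \in T)
    (I : multA T') : multA T :=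
  (exist _ (i |: val I.1) (add_subset sT iT I.1), I.2).

Lemma multA_set_add T T' i (sT : T' \subset T) (iT : i \in T) (I : multA T') :
  multA_set (multA_add sT iT I) = i |: multA_set I.
Proof. by rewrite /multA_set /= finset.setUA. Qed.

Lemma psd_unionm_shift T T' i f : T' \subset T -> i \in T ->
  psd (unionm T f) -> psd (unionm T' (fun I => f (i |: I))).
Proof.
move=> sT iT /(psd_reindex (multA_add sT iT)); congr psd.
apply/matrixP => j k; rewrite !mxE; congr f.
by rewrite !multA_set_add finset.setUACA finset.setUid.
Qed.

Lemma psd_unionm_coshift T T' i f : T' \subset T -> i \in T ->
  psd (unionm T f) -> psd (unionm T' (fun I => f I - f (i |: I))).
Proof.
move=> sT iT /(psd_difference (multA_widen sT) (multA_add sT iT)); congr psd.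
apply/matrixP => j k; rewrite [LHS]mxE [RHS]mxE.
set I := enum_val j; set J := enum_val k.
(* f (I :|: (i |: J)), f (i |: I :|: J) and f (i |: I :|: (i |: J)) agree. *)
have widenE (A : multA T') : multA_set (multA_widen sT A) = multA_set A by [].
rewrite !multA_set_add !widenE.
rewrite -(finset.setUA [set i]%SET (multA_set I) (i |: _)).
rewrite (finset.setUCA (multA_set I)) !finset.setUA finset.setUid.
by rewrite subrr subr0.
Qed.

(** The descent step for Y := localm f set0: the values of the shift on sets of
size at most one are the coordinates of Y e_i, and the two other conditions
pass to the shift from a T containing i. *)
Lemma witness_shift d K x f i : convex_cone K -> (d < #|V|)%N ->
  moment_witness d.+1 K x f ->
  moment_witness d K (localm f finset.set0 *m unitv R (ix1 i))
    (fun I => f (i |: I)).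
Proof.
move=> coneK dV [f0 fi psdf Kf]; split.
- by rewrite coordv_localm /= !finset.set0U finset.setU0.
- by move=> j; rewrite coordv_localm /= finset.set0U finset.setUC.
- move=> T /(exists_superset1 i dV)[T' [T'd sTT' iT']].
  by apply: psd_unionm_shift sTT' iT' (psdf _ T'd).
- rewrite localm_shift; have addK u v := @in_facesD K u v coneK.
  exact (level_positive_shift (in_faces0 coneK) addK i dV Kf).
Qed.

(** The same descent for Y (e_0 - e_i), whose coordinates are the values of the
co-shift. *)
Lemma witness_coshift d K x f i : convex_cone K -> (d < #|V|)%N ->
  moment_witness d.+1 K x f ->
  moment_witness d K
    (localm f finset.set0 *m (unitv R (ix0 V) - unitv R (ix1 i)))
    (fun I => f I - f (i |: I)).
Proof.
have coordvB (u v : vec R P1) a : coordv (u - v) a = coordv u a - coordv v a.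
  by rewrite /coordv !mxE.
move=> coneK dV [f0 fi psdf Kf]; rewrite mulmxBr; split.
- by rewrite coordvB !coordv_localm /= !finset.set0U !finset.setU0.
- move=> j; rewrite coordvB !coordv_localm /= !finset.set0U finset.setU0.
  by rewrite finset.setUC.
- move=> T /(exists_superset1 i dV)[T' [T'd sTT' iT']].
  by apply: psd_unionm_coshift sTT' iT' (psdf _ T'd).
- rewrite localmB localm_shift; have addK u v := @in_facesD K u v coneK.
  exact (level_positive_coshift (in_faces0 coneK) addK i dV Kf).
Qed.

(** For any T of size d, the matrix A_set0(y) is the block of M(T; y) indexed by
the empty set and the singletons, taken with S = set0; such a T exists because
d is at most the number of vertices. *)
Lemma witness_MplusV d K x f : (d <= #|V|)%N -> moment_witness d K x f ->
  MplusV (localm f finset.set0) /\ localm f finset.set0 *m unitv R (ix0 V) = x.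
Proof.
move=> dV [f0 fi psdf _]; split; [split|].
- have [T Td] := exists_set_card dV.
  pose phi (a : P1) : multA T := (exist _ finset.set0 (finset.sub0set T), a).
  have := psd_reindex phi (psdf T Td); congr psd; apply/matrixP => j k.
  by rewrite !mxE /multA_set /= !finset.set0U.
- move=> i; rewrite /coordm !mxE !enum_rankK /= !finset.set0U.
  by rewrite finset.setUid.
apply/colP => j; rewrite -[j]enum_valK -!/(coordv _ _) coordv_localm /=.
rewrite finset.set0U finset.setU0.
by have [->|[i ->]] := P1_case (enum_val j); rewrite /= ?f0 ?fi.
Qed.

Lemma Ltilde_subset_Nplus d (K : set (vec R P1)) :
  convex_cone K -> (d <= #|V|)%N ->
  Ltilde d.+1 K `<=` Nplus_iter d.+1 K.
Proof.
move=> coneK; elim: d => [|d IHd] dV x /LtildeP[f wf];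
  have [Mf fx] := witness_MplusV dV wf; exists (localm f finset.set0) => //;
  split=> // i.
  by case: wf => _ _ _ /level_positive0.
split; apply: (IHd (ltnW dV)); apply/LtildeP.
  by exists (fun I => f (i |: I)); apply: witness_shift wf.
by exists (fun I => f I - f (i |: I)); apply: witness_coshift wf.
Qed.

(** A function on sets whose matrix A_set0 is Y.  The enumeration of a pair
comes in an arbitrary order, which is harmless as Y is symmetric. *)
Definition pair_moments (Y : mat R P1) S : R :=
  match enum S with
  | [::] => coordm Y (ix0 V) (ix0 V)
  | [:: i] => coordm Y (ix0 V) (ix1 i)
  | i :: j :: _ => coordm Y (ix1 i) (ix1 j)
  end.

Lemma pair_momentsE Y a b : MplusV Y ->
  pair_moments Y (val a :|: val b) = coordm Y a b.
Proof.
move=> [[symY _] diagY].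
have coordmC c e : coordm Y c e = coordm Y e c.
  by rewrite /coordm -[in LHS]symY mxE.
have [->|[i ->]] := P1_case a; have [->|[j ->]] := P1_case b;
  rewrite /pair_moments /= ?finset.set0U ?finset.setU0 ?enum_set0 ?enum_set1//.
have [<-|ij] := eqVneq i j; first by rewrite finset.setUid enum_set1 diagY.
have := enum_uniq [set i; j]%SET; have := cards2 i j; rewrite cardE ij.
have : {subset enum [set i; j]%SET <= [set i; j]%SET}.
  by move=> k; rewrite mem_enum.
case: (enum _) => [|k [|l [|]]]//= sub _; rewrite andbT inE => kl.
have := sub k; have := sub l; rewrite !inE !eqxx orbT => /(_ isT) + /(_ isT).
move=> /orP[]/eqP lE /orP[]/eqP kE; move: kl.
all: by rewrite lE kE ?eqxx.
Qed.

Lemma Nplus_subset_Ltilde1 (K : set (vec R P1)) : Nplus K `<=` Ltilde 1 K.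
Proof.
move=> _ [Y [MY KY] <-]; apply/LtildeP; exists (pair_moments Y).
have YE : localm (pair_moments Y) finset.set0 = Y.
  apply/matrixP => j k; rewrite mxE finset.set0U pair_momentsE//.
  by rewrite /coordm !enum_valK.
have coordvY a : coordv (Y *m unitv R (ix0 V)) a = pair_moments Y (val a).
  by rewrite -{1}YE coordv_localm /= finset.set0U finset.setU0.
split; [by rewrite coordvY|by move=> i; rewrite coordvY| |]; last first.
  by rewrite level_positive0 YE.
move=> T /cards0_eq ->; have [[psdY _] _] := (MY, KY).
rewrite -YE in psdY.
have := psd_reindex (fun I : multA finset.set0 => I.2) psdY.
congr psd; apply/matrixP => j k; rewrite !mxE /multA_set.
have val0 (S : {S : {set V} | S \subset finset.set0}) : val S = finset.set0.
  by apply/eqP; rewrite -finset.subset0; apply: (valP S).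
by rewrite !val0 !finset.set0U.
Qed.

End Moments.

Theorem proposition2p5 (R : realType) (V : finType) (n : nat)
  (hV : #|V| = n) (K : set (vec R (subsets_le V 1)))
  (K_cone : convex_cone K)
  (K_box : K `<=` [set x | forall i : V,
                     0 <= coordv x (ix1 i) <= coordv x (ix0 V)]) :
  Ltilde 1 K = Nplus K /\
  forall t : nat, (2 <= t <= n.+1)%N -> Ltilde t K `<=` Nplus_iter t K.
Proof.
split.
  rewrite eqEsubset; split; last exact: Nplus_subset_Ltilde1.
  exact: (Ltilde_subset_Nplus (d := 0)).
case=> [//|d] /andP[_]; rewrite ltnS -hV => dV.
exact: Ltilde_subset_Nplus.
Qed.
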